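(* Let $n\ge 3$. Then $C_n\setminus\tilde M$ is a finite set.
   Context: For $n\ge 3$, $C_n$ is the monoid generated by $x_1,\dots,x_n$ with relations (indices modulo $n$) $x_i^2=x_i$; $x_ix_j=x_jx_i$ if $i,j$ are distinct and not cyclically adjacent; $x_ix_{i+1}x_i=x_{i+1}x_ix_{i+1}=x_ix_{i+1}$. Let $F$ be the free monoid on $x_1,\dots,x_n$ with the deg-lex order induced by $x_1<\cdots<x_n$. Each element of $C_n$ is identified with its reduced form, i.e. the deg-lex smallest word in $F$ representing it. A word $u$ is a factor of $v$ if $v=v_1uv_2$ in $F$. For $0\le i\le n-2$ let $q_i=x_1\cdots x_i\,x_{n-1}x_{n-2}\cdots x_{i+1}$ ($q_0=x_{n-1}\cdots x_1$), let $\tilde M_i$ be the set of elements of $C_n$ whose reduced form has a factor $x_nq_i$, and let $\tilde M=\bigcup_{i=0}^{n-2}\tilde M_i$. *)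

(* Defs.v *)
From HB Require Import structures.
From mathcomp Require Import all_boot all_order generic_quotient.
From mathcomp Require Import boolp classical_sets cardinality.

Set Implicit Arguments.
Unset Strict Implicit.
Unset Printing Implicit Defensive.

Local Open Scope classical_set_scope.
Local Open Scope quotient_scope.

(* The ordinal of value k stands for the generator x_{k+1}, so that the order
   of 'I_n is x_1 < ... < x_n; the free monoid on x_1, ..., x_n is the type of
   words under concatenation. *)
Definition word (n : nat) := seq 'I_n.

(* [ordS i] is the cyclic successor of i. *)
Inductive HK_rel (n : nat) : word n -> word n -> Prop :=
| HK_idem (i : 'I_n) : HK_rel [:: i; i] [:: i]
| HK_comm (i j : 'I_n) : i != j -> j != ordS i -> i != ordS j ->
    HK_rel [:: i; j] [:: j; i]
| HK_braidl (i : 'I_n) : HK_rel [:: i; ordS i; i] [:: i; ordS i]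
| HK_braidr (i : 'I_n) : HK_rel [:: ordS i; i; ordS i] [:: i; ordS i].

(* The least monoid congruence containing [HK_rel]. *)
Inductive HK_cong (n : nat) : word n -> word n -> Prop :=
| HK_step (u v a b : word n) : HK_rel a b -> HK_cong (u ++ a ++ v) (u ++ b ++ v)
| HK_refl (u : word n) : HK_cong u u
| HK_sym (u v : word n) : HK_cong u v -> HK_cong v u
| HK_trans (u v w : word n) : HK_cong u v -> HK_cong v w -> HK_cong u w.

Lemma HK_cat (n : nat) (u u' v v' : word n) :
  HK_cong u u' -> HK_cong v v' -> HK_cong (u ++ v) (u' ++ v').
Proof.
move=> uu' vv'; apply: (@HK_trans _ _ (u' ++ v)).
  elim: uu' => [x y a b ab|x|x y _ IH|x y z _ IH1 _ IH2].
  - by rewrite -!catA; apply: HK_step.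
  - exact: HK_refl.
  - exact: HK_sym.
  - exact: HK_trans IH1 IH2.
elim: vv' => [x y a b ab|x|x y _ IH|x y z _ IH1 _ IH2].
- by rewrite !(catA u'); apply: HK_step.
- exact: HK_refl.
- exact: HK_sym.
- exact: HK_trans IH1 IH2.
Qed.

Definition HK_congb (n : nat) : rel (word n) := fun u v => `[< HK_cong u v >].

Lemma HK_congb_refl (n : nat) : reflexive (@HK_congb n).
Proof. by move=> u; apply/asboolP/HK_refl. Qed.

Lemma HK_congb_sym (n : nat) : symmetric (@HK_congb n).
Proof. by move=> u v; apply/asboolP/asboolP; apply: HK_sym. Qed.

Lemma HK_congb_trans (n : nat) : transitive (@HK_congb n).
Proof. by move=> v u w /asboolP uv /asboolP vw; apply/asboolP/(HK_trans uv). Qed.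

Canonical HK_equiv (n : nat) : equiv_rel (word n) :=
  EquivRel (@HK_congb n) (@HK_congb_refl n) (@HK_congb_sym n)
    (@HK_congb_trans n).

Definition C (n : nat) := {eq_quot @HK_equiv n}.
HB.instance Definition _ (n : nat) := EqQuotient.on (C n).
HB.instance Definition _ (n : nat) := Choice.on (C n).

Definition toC (n : nat) (u : word n) : C n := \pi_(C n) u.

Lemma toC_eq (n : nat) (u v : word n) : toC u = toC v <-> HK_cong u v.
Proof. by split=> [/eqquotP/asboolP|uv]; last exact/eqquotP/asboolP. Qed.

Lemma toC_repr (n : nat) (a : C n) : toC (repr a) = a.
Proof. exact: reprK. Qed.

Definition C_mul (n : nat) (a b : C n) : C n := toC (repr a ++ repr b).

Lemma toC_cat (n : nat) (u v : word n) : toC (u ++ v) = C_mul (toC u) (toC v).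
Proof. by apply/toC_eq/HK_cat; apply/toC_eq; rewrite toC_repr. Qed.

Lemma C_mulA (n : nat) : associative (@C_mul n).
Proof.
move=> a b c; rewrite -(toC_repr a) -(toC_repr b) -(toC_repr c).
by rewrite -!toC_cat catA.
Qed.

Lemma C_mul1 (n : nat) : left_id (toC [::]) (@C_mul n).
Proof. by move=> a; rewrite -(toC_repr a) -toC_cat. Qed.

Lemma C_mulr1 (n : nat) : right_id (toC [::]) (@C_mul n).
Proof. by move=> a; rewrite -(toC_repr a) -toC_cat cats0. Qed.

HB.instance Definition _ (n : nat) :=
  isMonoid.Build (C n) (@C_mulA n) (@C_mul1 n) (@C_mulr1 n).

Definition deglex_le (n : nat) (u v : word n) : bool :=
  (size u < size v) ||
  ((size u == size v) && (u <= v :> seqlexi 'I_n)%O).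

Definition is_reduced_form (n : nat) (w : word n) (a : C n) : Prop :=
  toC w = a /\ forall v : word n, toC v = a -> deglex_le w v.

Lemma reduced_form_unique (n : nat) (a : C n) (w w' : word n) :
  is_reduced_form w a -> is_reduced_form w' a -> w = w'.
Proof.
move=> [wa wmin] [w'a w'min]; move: (wmin _ w'a) (w'min _ wa).
rewrite /deglex_le eq_sym; case: ltngtP => //= _ ww' w'w.
by apply: (@Order.POrderTheory.le_anti _ (seqlexi 'I_n)); rewrite ww' w'w.
Qed.

Lemma reduced_form_exists (n : nat) (a : C n) : exists w, is_reduced_form w a.
Proof.
have exm : exists m, `[< exists u : word n, toC u = a /\ size u = m >].
  by exists (size (repr a)); apply/asboolP; exists (repr a); rewrite toC_repr.
case: (ex_minnP exm) => m /asboolP[u [ua um]] mmin.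
pose P (t : m.-tuple 'I_n) := `[< toC (t : word n) = a >].
have Pu : P (tcast um (in_tuple u)) by apply/asboolP; rewrite val_tcast.
pose f (t : m.-tuple 'I_n) : seqlexi 'I_n := val t.
case: (@Order.TotalTheory.arg_minP _ _ _ _ P f Pu) => t /asboolP ta tmin.
exists (t : word n); split=> // v va; rewrite /deglex_le size_tuple.
have: m <= size v by apply: mmin; apply/asboolP; exists v.
rewrite leq_eqVlt => /predU1P[mv|->//]; rewrite {1 2}mv eqxx ltnn /=.
have := tmin (tcast (esym mv) (in_tuple v)); rewrite /f /= val_tcast; apply.
by apply/asboolP; rewrite val_tcast.
Qed.

(* The word x_a x_{a+1} ... x_b, for 1 <= a and b <= n (empty if a > b). *)
Definition x_run (n a b : nat) : word n :=
  [seq k <- enum 'I_n | a <= (val k).+1 <= b].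

Definition q (n i : nat) : word n := x_run n 1 i ++ rev (x_run n i.+1 n.-1).

(* [infix u v] says that u is a factor of v, and [x_run n n n] is the
   one-letter word x_n. *)
Definition Mtilde_i (n i : nat) : set (C n) :=
  [set a | exists2 w : word n,
    is_reduced_form w a & infix (x_run n n n ++ q n i) w].
Arguments Mtilde_i : clear implicits.

Definition Mtilde (n : nat) : set (C n) :=
  \bigcup_(i in [set i : nat | i <= n - 2]) Mtilde_i n i.
Arguments Mtilde : clear implicits.

(* Main.v *)
Require Import Defs.
From mathcomp Require Import all_boot all_order zify.
From mathcomp Require Import classical_sets cardinality.

Local Open Scope classical_set_scope.

(** Reduced forms are the words that are deg-lex minimal in their congruence
    class, and a long reduced word is shown to contain some [x_n q_i].

    Minimality is used through two consequences only.
    - Absorption: [x_i s x_i] equals [x_i s] if [x_{i-1}] does not occur in [s],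
      and equals [s x_i] if [x_{i+1}] does not.  So by minimal length, both
      cyclic neighbours of [x_i] occur between any two occurrences of [x_i]
      ([reduced_between]).
    - Commutation: in a factor [y s x] with [x < y], the letter [x] cannot be
      moved in front of [y], so some letter of [y s] is [x] or a neighbour of
      [x] ([reduced_blocked]).  With [y = x_n] this applies to every other
      letter [x].

    Cut a reduced word at the occurrences of its largest letter [x_n].  In a
    segment that follows an [x_n], every letter other than [x_1] and [x_{n-1}]
    is preceded by itself or a neighbour, so descending along such obstacles
    ends at [x_1] or [x_{n-1}].  This descent shows that no letter is repeated
    within a segment ([reduced_no_repeat]), and that a segment between two
    [x_n] contains, with each letter of the next segment, also its neighbours
    other than [x_n] ([previous_segment_mem]).  Since [x_1] lies in every such segment, a
    segment followed by sufficiently many [x_n] contains all of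
    [x_1, ..., x_{n-1}], each exactly once.

    In such a full segment each inner letter comes after one of its
    neighbours: the segment is a shuffle of [x_1 x_2 ...] with
    [x_{n-1} x_{n-2} ...].  Commutation also forbids a descent between two
    consecutive non-adjacent letters, which leaves only the shuffles [q_i]
    ([unimodal_word]).  Hence a reduced word with more than [n - 1] letters
    [x_n] has a factor [x_n q_i].

    By absorption, the multiplicities of neighbouring letters in a reduced word
    differ by at most one, so bounding the number of [x_n] bounds the length,
    and there are finitely many words of bounded length. *)

(** * Absorption and commutation in the monoid *)

Definition adj {n} (i j : 'I_n) := (j == ordS i) || (i == ordS j).

Definition reduced {n} (w : word n) := forall v, HK_cong w v -> deglex_le w v.

Lemma adjC {n} (i j : 'I_n) : adj i j = adj j i.
Proof. by rewrite /adj orbC. Qed.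

Lemma HK_ctx {n} (u v a b : word n) :
  HK_cong a b -> HK_cong (u ++ a ++ v) (u ++ b ++ v).
Proof.
by move=> ab; apply/HK_cat/HK_cat; [exact: HK_refl | exact: ab | exact: HK_refl].
Qed.

Lemma HK_rel_cong {n} (a b : word n) : HK_rel a b -> HK_cong a b.
Proof. by move=> ab; have := HK_step [::] [::] ab; rewrite !cats0. Qed.

Lemma HK_cong_comm {n} (x y : 'I_n) :
  x != y -> ~~ adj x y -> HK_cong [:: x; y] [:: y; x].
Proof. by move=> xy /norP[yx xy']; apply/HK_rel_cong/HK_comm. Qed.

(** Induction on [s] from the right.  Only a last letter [ordS i] of [s], for
    [i := ordS j], resists commutation with the final [i]; the induction
    hypothesis then inserts an [i] just before it, and the braid relation
    [i (i+1) i = i (i+1)] removes the final one. *)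
Lemma absorb_right {n} (j : 'I_n) (s : word n) : j \notin s ->
  HK_cong (ordS j :: s ++ [:: ordS j]) (ordS j :: s).
Proof.
set i := ordS j; elim/last_ind: s => [|s y IHs].
  by move=> _; apply/HK_rel_cong/HK_idem.
rewrite mem_rcons in_cons => /norP[jy /IHs {}IHs].
rewrite -cats1 -catA /=.
have [->|yi] := eqVneq y i.
  exact: (HK_ctx (i :: s) [::] _ _ (HK_rel_cong _ _ (HK_idem i))).
have [->|yS] := eqVneq y (ordS i).
  apply: (@HK_trans _ _ (i :: s ++ [:: i; ordS i; i])).
    have := HK_ctx [::] [:: ordS i; i] _ _ (HK_sym IHs).
    by rewrite /= -catA.
  apply: (@HK_trans _ _ (i :: s ++ [:: i; ordS i])).
    exact: (HK_ctx (i :: s) [::] _ _ (HK_rel_cong _ _ (HK_braidl i))).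
  by have := HK_ctx [::] [:: ordS i] _ _ IHs; rewrite /= -catA.
apply: (@HK_trans _ _ (i :: s ++ [:: i; y])).
  apply: (HK_ctx (i :: s) [::] [:: y; i] [:: i; y]); apply: HK_cong_comm => //.
  rewrite /adj (negPf yS) orbF (inj_eq (@ordS_inj n)).
  by rewrite eq_sym in jy; rewrite eq_sym.
by have := HK_ctx [::] [:: y] _ _ IHs; rewrite /= -catA.
Qed.

(** Mirror image of [absorb_right], using the other braid relation. *)
Lemma absorb_left {n} (i : 'I_n) (s : word n) : ordS i \notin s ->
  HK_cong (i :: s ++ [:: i]) (s ++ [:: i]).
Proof.
elim: s => [|y s IHs]; first by move=> _; apply/HK_rel_cong/HK_idem.
rewrite in_cons => /norP[yS /IHs {}IHs] /=.
have [->|yi] := eqVneq y i.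
  exact: (HK_ctx [::] (s ++ [:: i]) _ _ (HK_rel_cong _ _ (HK_idem i))).
have [iy|iy] := eqVneq i (ordS y).
  apply: (@HK_trans _ _ ([:: i; y; i] ++ s ++ [:: i])).
    by have := HK_ctx [:: i; y] [::] _ _ (HK_sym IHs); rewrite !cats0.
  apply: (@HK_trans _ _ ([:: y; i] ++ s ++ [:: i])).
    rewrite iy.
    exact: (HK_ctx [::] (s ++ [:: ordS y]) _ _ (HK_rel_cong _ _ (HK_braidr y))).
  by have := HK_ctx [:: y] [::] _ _ IHs; rewrite !cats0.
apply: (@HK_trans _ _ (y :: i :: s ++ [:: i])).
  apply: (HK_ctx [::] (s ++ [:: i]) [:: i; y] [:: y; i]); apply: HK_cong_comm.
    by rewrite eq_sym.
  by rewrite /adj (negPf iy) orbF eq_sym.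
by have := HK_ctx [:: y] [::] _ _ IHs; rewrite !cats0.
Qed.

(** * Minimal words *)

Lemma reduced_size {n} (w v : word n) :
  reduced w -> HK_cong w v -> size w <= size v.
Proof.
by move=> wr /wr /orP[/ltnW //|/andP[/eqP -> _]].
Qed.

(** If the neighbour [j] were absent from [s], one of the two letters [i] could
    be absorbed, giving a shorter word. *)
Lemma reduced_between {n} (a s b : word n) (i j : 'I_n) :
  reduced (a ++ i :: s ++ i :: b) -> adj i j -> j \in s.
Proof.
move=> wr /orP ij; apply: contraT => js.
have long v : HK_cong (i :: s ++ [:: i]) v -> size v = (size s).+1 -> false.
  move=> /(HK_ctx a b) c vs; have := reduced_size (a ++ i :: s ++ i :: b) _ wr.
  move: c; rewrite /= -catA /= => c /(_ _ c).
  by rewrite !size_cat /= size_cat /= vs leq_add2l addSn !addnS ltnn.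
case: ij => [/eqP ji|/eqP ij].
  by apply: long (absorb_left i s _) _; rewrite -?ji // size_cat addn1.
by apply: (long (i :: s)) => //; rewrite ij; apply: absorb_right.
Qed.

Lemma commute_past {n} (s : word n) (x : 'I_n) :
  (forall y, y \in s -> (x != y) && ~~ adj x y) ->
  HK_cong (s ++ [:: x]) (x :: s).
Proof.
elim: s => [|y s IHs] ys; first exact: HK_refl.
have [xy nxy] := andP (ys y (mem_head y s)).
apply: (@HK_trans _ _ (y :: x :: s)).
  have := HK_ctx [:: y] [::] _ _ (IHs _); rewrite !cats0; apply => z zs.
  by apply: ys; rewrite in_cons zs orbT.
by apply: (HK_ctx [::] s [:: y; x] [:: x; y]); apply/HK_sym/HK_cong_comm.
Qed.

Lemma lexi_drop {n} (a b c : word n) :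
  (a ++ b <= a ++ c :> seqlexi 'I_n)%O = (b <= c :> seqlexi 'I_n)%O.
Proof. by elim: a => //= x a <-; rewrite Order.SeqLexiOrder.eqhead_lexiE. Qed.

(** Otherwise [x] could be moved in front of [y], giving a lexicographically
    smaller word of the same length. *)
Lemma reduced_blocked {n} (a s b : word n) (x y : 'I_n) :
  reduced (a ++ y :: s ++ x :: b) -> x < y ->
  exists2 z, z \in y :: s & (z == x) || adj x z.
Proof.
move=> wr xy; apply/hasP; apply: contraT => /hasPn nadj.
have c : HK_cong ((y :: s) ++ [:: x]) (x :: y :: s).
  by apply: commute_past => z /nadj; rewrite negb_or eq_sym.
have := HK_ctx a b _ _ c; rewrite /= -catA /= => /wr; rewrite /deglex_le.
rewrite !size_cat /= !size_cat /= !addnS ltnn eqxx /= lexi_drop.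
have xy' : (y <= x :> 'I_n)%O = false by apply/negbTE; rewrite -Order.TotalTheory.ltNge.
by rewrite Order.SeqLexiOrder.lexi_cons xy'.
Qed.

(** * Splitting sequences at given entries *)

Lemma split_first {T : eqType} (x : T) (s : seq T) : x \in s ->
  exists a b, s = a ++ x :: b /\ x \notin a.
Proof.
elim: s => // y s IHs; have [<- _|xy] := eqVneq x y; first by exists [::], s.
rewrite in_cons (negPf xy) => /IHs[a [b [-> xa]]]; exists (y :: a), b.
by rewrite in_cons (negPf xy).
Qed.

Lemma split_repeat {T : eqType} (s : seq T) : ~~ uniq s ->
  exists x a c b, s = a ++ x :: c ++ x :: b.
Proof.
elim: s => //= y s IHs; rewrite negb_and negbK => /orP[/split_first|/IHs].
  by move=> [c [b [-> _]]]; exists y, [::], c, b.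
by move=> [x [a [c [b ->]]]]; exists x, (y :: a), c, b.
Qed.

(** Cutting [w] just before its second [x] removes one [x] and at least one [y]. *)
Lemma count_between {T : eqType} (x y : T) (w : seq T) : x != y ->
  (forall a s b, w = a ++ x :: s ++ x :: b -> y \in s) ->
  count_mem x w <= (count_mem y w).+1.
Proof.
move=> xy; have [k] := ubnP (size w).
elim: k w => // k IHk w wk btw.
have [/split_first[a [b [wE xa]]]|/count_memPn -> //] := boolP (x \in w).
have [/split_first[c [d [bE xc]]]|xb] := boolP (x \in b); last first.
  by rewrite wE count_cat /= eqxx (count_memPn xa) (count_memPn xb).
have yc : y \in c by apply: (btw a c d); rewrite wE bE.
have {}IHk : count_mem x (x :: d) <= (count_mem y (x :: d)).+1.
  apply: IHk => [|a' s' b' dE].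
    by move: wk; rewrite wE bE !size_cat /= !size_cat /=; lia.
  by apply: (btw (a ++ x :: c ++ a') s' b'); rewrite wE bE dE /= -!catA /= -?catA.
move: yc IHk; rewrite -has_pred1 has_count wE bE !count_cat /= !count_cat /= eqxx.
by rewrite (negPf xy) (count_memPn xa) (count_memPn xc); lia.
Qed.

(** * Segments between occurrences of the largest letter *)

(** Infinite descent on the position of the first of two equal letters [j].
    Since [N] does not lie between them, [j] is not adjacent to [N]; so the
    obstacle to moving the first [j] in front of [N] lies in [u].  It is either
    an earlier [j], or a neighbour [z] of [j], which by [reduced_between] recurs
    between the two letters [j].  Both give a repetition that starts earlier. *)
Lemma reduced_no_repeat {n} (N : 'I_n) (A u B : word n) :
  (forall i, i != N -> i < N) -> reduced (A ++ N :: u ++ B) -> N \notin u -> uniq u.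
Proof.
move=> Nmax wr Nu.
suff rep k a s b (j : 'I_n) : size a < k -> u = a ++ j :: s ++ j :: b -> false.
  apply: contraT => /split_repeat[j [a [s [b uE]]]].
  exact: (rep (size a).+1 a s b j).
elim: k a s b j => // k IHk a s b j ak uE.
have [jN Ns Na] : [/\ j != N, N \notin s & N \notin a].
  move: Nu; rewrite uE !(mem_cat, in_cons) !negb_or => /and4P[-> jN -> _].
  by rewrite eq_sym.
have /reduced_blocked/(_ (Nmax _ jN)) [z] :
    reduced (A ++ N :: a ++ j :: (s ++ j :: b ++ B)).
  by move: wr; rewrite uE -!catA /= -?catA.
have btw i : adj j i -> i \in s.
  apply: (@reduced_between _ (A ++ N :: a) _ (b ++ B)).
  by move: wr; rewrite uE -!catA /= -?catA.
rewrite in_cons => /predU1P[->|za].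
  by rewrite eq_sym (negPf jN) => /btw; rewrite (negPf Ns).
have [a1 [a2 [aE _]]] := split_first _ _ za.
have a1k : size a1 < k by move: ak; rewrite aE size_cat /=; lia.
move=> /predU1P[zj|/btw zs].
  by apply: (IHk a1 a2 (s ++ j :: b) j) => //; rewrite uE aE zj -catA.
have [s1 [s2 [sE _]]] := split_first _ _ zs.
apply: (IHk a1 (a2 ++ j :: s1) (s2 ++ j :: b) z) => //.
by rewrite uE aE sE -!catA /= -?catA.
Qed.

(** Induction on the position of [i]; for [i] equal to [N], the neighbour [j] lies
    between the two displayed [N].  For [i] other than [N], the obstacle to moving [i] in front of
    the second [N] is either that [N], so that [i] is adjacent to [N] and lies
    between the two [N], or an earlier letter to which the induction hypothesis
    applies; so [i] is in [u].  A neighbour [j] then lies between that [i] and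
    the later one: either in [u], or again at an earlier position. *)
Lemma previous_segment_mem {n} (N : 'I_n) (A u a b : word n) (i j : 'I_n) :
  (forall i, i != N -> i < N) -> reduced (A ++ N :: u ++ N :: a ++ i :: b) ->
  (i == j) || adj i j -> j != N -> j \in u.
Proof.
move=> Nmax; have [k] := ubnP (size a).
elim: k a b i j => // k IHk a b i j ak wr ij jN.
have btwN x : adj N x -> x \in u.
  by apply: reduced_between; exact: wr.
have [iN|iN] := eqVneq i N.
  by apply: btwN; move: ij; rewrite iN eq_sym (negPf jN).
have split_at z : z \in a -> exists2 a1, size a1 < k & exists b', a ++ i :: b = a1 ++ z :: b'.
  move=> /split_first[a1 [a2 [aE _]]]; exists a1; last first.
    by exists (a2 ++ i :: b); rewrite aE -catA.
  by move: ak; rewrite aE size_cat /=; lia.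
have iu : i \in u.
  have wr' : reduced ((A ++ N :: u) ++ N :: a ++ i :: b) by rewrite -catA.
  have [z] := reduced_blocked _ _ _ _ _ wr' (Nmax _ iN).
  rewrite in_cons => /predU1P[->|/split_at[a1 a1k [b' E]]] iz.
    by apply: btwN; rewrite adjC; move: iz; rewrite eq_sym (negPf iN).
  by apply: (IHk a1 b' z i) => //; rewrite -?E // (adjC z).
move: ij => /predU1P[<- //|ij].
have [u1 [u2 [uE _]]] := split_first _ _ iu.
have : j \in u2 ++ N :: a.
  apply: (@reduced_between _ (A ++ N :: u1) _ b i) => //.
  by move: wr; rewrite uE -!catA /= -?catA.
rewrite mem_cat in_cons (negPf jN) /= => /orP[ju2|/split_at[a1 a1k [b' E]]].
  by rewrite uE mem_cat in_cons ju2 !orbT.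
by apply: (IHk a1 b' j j) => //; rewrite ?eqxx // -E.
Qed.

Lemma lt_max {n} (i : 'I_n.+1) : i != ord_max -> i < (ord_max : 'I_n.+1).
Proof. by move=> iN; rewrite ltn_neqAle iN -ltnS ltn_ord. Qed.

Lemma adj_max0 {n} : adj (ord_max : 'I_n.+1) ord0.
Proof. by rewrite /adj -val_eqE /= modnn. Qed.

Lemma adj_succ {n} (i j : 'I_n.+1) : j = i.+1 :> nat -> adj i j.
Proof.
by move=> ji; rewrite /adj -val_eqE /= ji modn_small ?eqxx // -ji ltn_ord.
Qed.

Lemma adj_below_max {n} (i j : 'I_n.+1) : i != ord_max -> j != ord_max ->
  adj i j -> j = i.+1 :> nat \/ i = j.+1 :> nat.
Proof.
move=> /lt_max iN /lt_max jN; rewrite /adj -!val_eqE /= !modn_small //.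
by case/orP => /eqP; [left | right].
Qed.

(** The letter of index 0 is in every segment by adjacency to [ord_max], and each
    step back from a segment to the previous one gains the next index. *)
Lemma full_segment {n} (A u B : word n.+1) (t : nat) (j : 'I_n.+1) :
  reduced (A ++ ord_max :: u ++ ord_max :: B) -> t <= count_mem ord_max B ->
  j <= t -> j != ord_max -> j \in u.
Proof.
elim: t A u B j => [|t IHt] A u B j wr tB jt jN.
  have -> : j = ord0 by apply/val_inj/eqP; rewrite -leqn0.
  exact: (reduced_between _ _ _ _ _ wr adj_max0).
have [u' [B' [BE Nu']]] : exists a b, B = a ++ ord_max :: b /\ ord_max \notin a.
  by apply: split_first; rewrite -has_pred1 has_count; apply: leq_trans tB.
have tB' : t <= count_mem ord_max B'.
  by move: tB; rewrite BE count_cat /= eqxx (count_memPn Nu').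
have [jt'|jt'] := leqP j t.
  apply: (IHt A u B) => //; apply: ltnW; exact: tB.
have tn : t < n.+1 by apply: leq_trans (ltn_ord j); exact: ltnW.
pose i : 'I_n.+1 := Ordinal tn.
have ji : j = i.+1 :> nat by apply/eqP; rewrite eqn_leq jt jt'.
have iN : i != ord_max.
  by move: (lt_max _ jN) ji; rewrite -val_eqE /= => jn ji; lia.
have : i \in u'.
  apply: (IHt (A ++ ord_max :: u) u' B') => //.
  by move: wr; rewrite BE -!catA.
move=> /split_first[a [b [u'E _]]].
apply: (@previous_segment_mem _ ord_max A u a (b ++ ord_max :: B') i j) => //.
- exact: lt_max.
- by move: wr; rewrite BE u'E -!catA.
- by rewrite adj_succ ?orbT.
Qed.

(** * Bounding the length by the number of largest letters *)

(** Going up from [i] to the largest letter by successors, the multiplicity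
    drops by at most one at each step. *)
Lemma count_le_max {n} (w : word n.+2) (i : 'I_n.+2) : reduced w ->
  count_mem i w <= count_mem ord_max w + (n.+1 - i).
Proof.
move=> wr; have [k] := ubnP (n.+1 - i).
elim: k i => // k IHk i ik.
have [->|iN] := eqVneq i ord_max; first by rewrite leq_addr.
have i_lt : i.+1 < n.+2 by rewrite ltnS; exact: lt_max iN.
have adj_i : adj i (Ordinal i_lt) by exact: adj_succ.
have le1 : count_mem i w <= (count_mem (Ordinal i_lt) w).+1.
  apply: count_between => [|a s b wE]; first by rewrite -val_eqE /= neq_ltn leqnn.
  by move: wr; rewrite wE => /reduced_between; apply.
apply: leq_trans le1 _; have iN' : i < n.+1 by exact: lt_max.
have /IHk : n.+1 - Ordinal i_lt < k by rewrite /=; lia.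
by rewrite -ltnS => /leq_trans; apply; rewrite -addnS /= subSS subSn.
Qed.

Lemma size_sum_count {T : finType} (w : seq T) :
  size w = \sum_(x : T) count_mem x w.
Proof.
elim: w => /= [|y w IHw]; first by rewrite big1.
by rewrite big_split /= -IHw (bigD1 y) //= eqxx big1 // => x; rewrite eq_sym => /negPf ->.
Qed.

Lemma reduced_size_bound {n} (w : word n.+2) (k : nat) : reduced w ->
  count_mem ord_max w <= k -> size w <= n.+2 * (k + n.+1).
Proof.
move=> wr wk; rewrite size_sum_count -[X in X * _]card_ord -sum_nat_const.
apply: leq_sum => i _; apply: leq_trans (count_le_max w i wr) _.
exact: leq_add wk (leq_subr _ _).
Qed.

(** * The form of a full segment *)

(** The first entry has no predecessor, so it is one of the two ends of the
    interval; removing it leaves a word of the same kind on a shorter interval.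
    If it is the upper end, the descent condition forces the next entry to be
    the new upper end, and so on: the rest is decreasing. *)
Lemma unimodal_word (m lo : nat) (v : seq nat) :
  0 < m -> perm_eq v (iota lo m) ->
  (forall a b x y, v = a ++ y :: x :: b -> x < y -> y = x.+1) ->
  (forall a b c, v = a ++ c :: b -> lo < c -> c.+1 < lo + m ->
     (c.-1 \in a) || (c.+1 \in a)) ->
  exists2 i, i < m & v = iota lo i ++ rev (iota (lo + i) (m - i)).
Proof.
elim: m lo v => // m IHm lo v _ vp desc pred.
have [m0|m0] := posnP m.
  by exists 0 => //=; move: vp; rewrite m0 addn0 => /perm_small_eq ->.
case: v vp desc pred => [/perm_size //|x v vp desc pred].
have mem_v z : (z \in x :: v) = (lo <= z < lo + m.+1).
  by rewrite (perm_mem vp) mem_iota.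
have desc' a b z y : v = a ++ y :: z :: b -> z < y -> y = z.+1.
  by move=> vE; apply: (desc (x :: a) b); rewrite vE.
have [xlo|xlo] := eqVneq x lo.
  subst x.
  have vp' : perm_eq v (iota lo.+1 m) by move: vp; rewrite /= perm_cons.
  (* The removed entry [lo] is not a neighbour of an inner entry of the
     shorter interval, so the predecessor condition passes to [v]. *)
  have [a b c vE loc cm|i im vE] := IHm lo.+1 v m0 vp' desc'.
    have := pred (lo :: a) b c; rewrite vE => /(_ erefl); rewrite !in_cons.
    have -> : (c.-1 == lo) = false by lia.
    have -> : (c.+1 == lo) = false by lia.
    by apply; lia.
  by exists i.+1 => //; rewrite vE /= addSnnS subSS.
have xhi : x = lo + m.
  have /andP[lox xm] : lo <= x < lo + m.+1 by rewrite -mem_v mem_head.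
  apply/eqP; apply: contraT => xm'.
  by have := pred [::] v x erefl; rewrite !in_nil; apply; lia.
have vp' : perm_eq v (iota lo m).
  rewrite -(perm_cons x) (perm_trans vp) //.
  by rewrite -addn1 iotaD /= -xhi cats1 perm_rcons.
have [a b c vE loc cm|i im vE] := IHm lo v m0 vp' desc'.
  have := pred (x :: a) b c; rewrite vE => /(_ erefl); rewrite !in_cons.
  have -> : (c.-1 == x) = false by lia.
  have -> : (c.+1 == x) = false by lia.
  by apply; lia.
(* If [i] were positive, [v] would start with [lo], so [x] followed by [lo] would
   be a descent by 1 and [m] would be 1, against [0 < i < m]. *)
have i0 : i = 0.
  case: i im vE => // i im vE.
  have := desc [::] (iota lo.+1 i ++ rev (iota (lo + i.+1) (m - i.+1))) lo x.
  by rewrite vE /= => /(_ erefl); lia.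
by exists 0 => //; rewrite vE i0 /= addn0 !subn0 -rev_rcons -cats1 xhi -(iotaD lo m 1) addn1.
Qed.

(** * The words [q_i] in terms of indices *)

Lemma filter_iota_interval (m a b : nat) : a <= b -> b <= m ->
  [seq k <- iota 0 m | a < k.+1 <= b] = iota a (b - a).
Proof.
move=> ab bm; have -> : m = a + ((b - a) + (m - b)) by lia.
rewrite !iotaD !filter_cat add0n subnKC //.
rewrite (@eq_in_filter _ _ pred0) ?filter_pred0 => [|k]; last first.
  by rewrite mem_iota /=; lia.
rewrite (@eq_in_filter _ _ predT) ?filter_predT => [|k]; last first.
  by rewrite mem_iota /=; lia.
rewrite (@eq_in_filter _ _ pred0) ?filter_pred0 ?cats0 // => k.
by rewrite mem_iota /=; lia.
Qed.

Lemma val_x_run (n a b : nat) : a <= b -> b <= n ->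
  map val (x_run n a.+1 b) = iota a (b - a).
Proof.
move=> ab bn; rewrite /x_run -(filter_map val (fun k => a < k.+1 <= b)) val_enum_ord.
exact: filter_iota_interval.
Qed.

Lemma x_runnn (n : nat) : x_run n.+1 n.+1 n.+1 = [:: ord_max].
Proof. by apply: (inj_map val_inj); rewrite val_x_run // subSnn. Qed.

Lemma val_q (n i : nat) : i <= n ->
  map val (q n.+1 i) = iota 0 i ++ rev (iota i (n - i)).
Proof.
by move=> ni; rewrite /q map_cat map_rev !val_x_run ?subn0 //; exact: leqW.
Qed.

(** * Long reduced words and finiteness *)

(** The segment after the first [x_n] is followed by enough further [x_n] for
    [full_segment] to reach all letters; the hypotheses of [unimodal_word] on it
    are [reduced_blocked] for consecutive letters and for the preceding [x_n]. *)
Lemma many_max_factor {n} (w : word n.+2) : reduced w ->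
  n.+1 < count_mem ord_max w ->
  exists2 i, i <= n & infix (ord_max :: q n.+2 i) w.
Proof.
move=> wr wN.
have [A [w1 [wE NA]]] : exists a b, w = a ++ ord_max :: b /\ ord_max \notin a.
  by apply: split_first; rewrite -has_pred1 has_count; apply: leq_trans wN.
have [u [B [w1E Nu]]] : exists a b, w1 = a ++ ord_max :: b /\ ord_max \notin a.
  apply: split_first; rewrite -has_pred1 has_count.
  by move: wN; rewrite wE count_cat /= eqxx (count_memPn NA); lia.
have nB : n <= count_mem ord_max B.
  move: wN; rewrite wE w1E count_cat /= eqxx count_cat /= eqxx.
  by rewrite (count_memPn NA) (count_memPn Nu); lia.
move: wr; rewrite wE w1E => wr.
have u_uniq : uniq u by apply: reduced_no_repeat wr Nu; exact: lt_max.
have u_neq z : z \in u -> z != ord_max.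
  by move=> zu; apply: contraNneq Nu => <-.
have up : perm_eq (map val u) (iota 0 n.+1).
  apply: uniq_perm; rewrite ?iota_uniq ?(map_inj_uniq val_inj) // => k.
  rewrite mem_iota /=; apply/mapP/idP => [[z /u_neq /lt_max zn ->] //|kn].
  have kn2 : k < n.+2 by exact: leqW.
  exists (Ordinal kn2) => //; apply: (full_segment A u B n) => //.
  by rewrite -val_eqE /= neq_ltn kn.
have split_val a c b : map val u = a ++ c :: b ->
    exists a' (x : 'I_n.+2) b', [/\ u = a' ++ x :: b', map val a' = a, val x = c & map val b' = b].
  move=> uE; exists (take (size a) u).
  have : map val (drop (size a) u) = c :: b by rewrite map_drop uE drop_size_cat.
  case dE: (drop _ _) => [//|x b'] /= [xc bE]; exists x, b'; split => //.
    by rewrite -dE cat_take_drop.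
  by rewrite map_take uE take_size_cat.
have desc a b x y : map val u = a ++ y :: x :: b -> x < y -> y = x.+1.
  move=> /split_val[a' [y' [b' [uE aE <-]]]].
  case: b' uE => // x' b' uE /= [<- _] xy.
  have wr' : reduced ((A ++ ord_max :: a') ++ y' :: [::] ++ x' :: (b' ++ ord_max :: B)).
    by move: wr; rewrite uE -!catA.
  have [z] := reduced_blocked _ _ _ _ _ wr' xy.
  rewrite mem_seq1 => /eqP -> /orP[/eqP yx|]; first by move: xy; rewrite yx ltnn.
  have x'N : x' != ord_max by apply: u_neq; rewrite uE mem_cat !in_cons eqxx !orbT.
  have y'N : y' != ord_max by apply: u_neq; rewrite uE mem_cat !in_cons eqxx !orbT.
  by move=> /adj_below_max[] //; lia.
have pred a b c : map val u = a ++ c :: b -> 0 < c -> c.+1 < n.+1 ->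
    (c.-1 \in a) || (c.+1 \in a).
  move=> /split_val[a' [c' [b' [uE <- <- _]]]] c0 cn.
  have c'N : c' != ord_max by apply: u_neq; rewrite uE mem_cat mem_head orbT.
  have wr' : reduced (A ++ ord_max :: a' ++ c' :: (b' ++ ord_max :: B)).
    by move: wr; rewrite uE -!catA.
  have [z] := reduced_blocked _ _ _ _ _ wr' (lt_max _ c'N).
  rewrite in_cons => /predU1P[->|za].
    by rewrite eq_sym (negPf c'N) /adj -!val_eqE /= modnn modn_small; move: c0 cn => /=; lia.
  have zN : z != ord_max by apply: u_neq; rewrite uE mem_cat za.
  move=> /predU1P[zc|/adj_below_max[] // zc].
  + by move: u_uniq; rewrite uE cat_uniq -zc => /and3P[_ /hasPn/(_ z (mem_head _ _))]; rewrite za.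
  + by rewrite -zc (map_f val za) orbT.
  + by apply/orP; left; move: (map_f val za); rewrite /= zc.
have [i im uE] := unimodal_word n.+1 0 (map val u) isT up desc pred.
exists i => //; apply/infixP; exists A, (ord_max :: B).
have -> // : q n.+2 i = u.
by apply: (inj_map val_inj); rewrite uE val_q // ltnW.
Qed.

Lemma finite_short_words {T : finType} (k : nat) :
  finite_set [set w : seq T | size w <= k].
Proof.
pose all_words := flatten [seq map val (enum {: m.-tuple T}) | m <- iota 0 k.+1].
apply: sub_finite_set (finite_seq all_words) => w /= wk.
apply/flatten_mapP; exists (size w); first by rewrite mem_iota.
by apply/mapP; exists (in_tuple w); rewrite ?mem_enum.
Qed.

Theorem proposition2p14 (n : nat) (hn : 3 <= n) :
  finite_set ([set: C n] `\` Mtilde n).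
Proof.
case: n hn => [|[|n]] // hn.
apply: sub_finite_set
  (finite_image (@toC n.+2) (finite_short_words (n.+2 * (n.+1 + n.+1)))).
move=> a [_ aM]; have [w wa] := reduced_form_exists a; case: (wa) => wE wmin.
exists w => //=.
have wr : reduced w by move=> v wv; apply: wmin; rewrite -wE; apply/toC_eq/HK_sym.
apply: reduced_size_bound => //; rewrite leqNgt; apply/negP.
move=> /(many_max_factor _ wr)[i ni wi]; apply: aM; exists i.
  by rewrite /= !subSS subn0.
by exists w => //; rewrite x_runnn.
Qed.
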